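(* No left-invariant affine structure on the oscillator group $G_\lambda$ is compatible with a left-invariant Lorentzian metric; that is, there is no left-invariant flat torsion-free affine connection on $G_\lambda$ which is the Levi-Civita connection of a left-invariant Lorentzian metric on $G_\lambda$.
   Context: Let $n\ge 1$ and $\lambda=(\lambda_1,\ldots,\lambda_n)\in\mathbb{R}^n$ with $0<\lambda_1\le\cdots\le\lambda_n$. The oscillator group $G_\lambda$ is the simply connected Lie group with underlying manifold $\mathbb{R}\times\mathbb{R}\times\mathbb{C}^n$ and product $$(t,s,z_1,\ldots,z_n)\cdot(t',s',z'_1,\ldots,z'_n)=\Big(t+t',\,s+s'+\tfrac12\sum_{j=1}^n\mathrm{Im}(\bar z_j e^{it\lambda_j}z'_j),\,\ldots,z_j+e^{it\lambda_j}z'_j,\ldots\Big).$$ Its Lie algebra $\mathfrak{g}_\lambda$ has basis $e_{-1},e_0,e_1,\ldots,e_n,\check e_1,\ldots,\check e_n$ with brackets $[e_{-1},e_j]=\lambda_j\check e_j$, $[e_j,\check e_j]=e_0$, $[e_{-1},\check e_j]=-\lambda_j e_j$, the other brackets being zero or deduced by antisymmetry. A left-invariant affine structure is a left-invariant affine connection with zero curvature and zero torsion. A Lorentzian metric is a pseudo-Riemannian metric of index $1$ (exactly one negative direction). *)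

(* Defs.v *)
From HB Require Import structures.
From mathcomp Require Import all_boot all_order all_algebra.
From mathcomp Require Import complex ring.
From mathcomp Require Import all_classical all_reals all_analysis.
Set Implicit Arguments.
Unset Strict Implicit.
Unset Printing Implicit Defensive.
Import Order.TTheory GRing.Theory Num.Theory.
Import numFieldNormedType.Exports.
Local Open Scope classical_set_scope.
Local Open Scope ring_scope.

Section Smooth.
Variables (R : realType) (U W : normedModType R).

(* For finite-dimensional [U] (the only use below), the directional
   derivatives 'D_v f, for fixed v, carry the same information as the total
   derivative, so this is the usual notion of a map of class C^k. *)
Fixpoint Ck (k : nat) (f : U -> W) : Prop :=
  if k is k'.+1 then
    (forall p, differentiable f p) /\ (forall v, Ck k' (fun p => 'D_v f p))
  else continuous f.

Definition smooth (f : U -> W) : Prop := forall k, Ck k f.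

End Smooth.

(* The manifold is a normed space [V] with its single global chart, so that all
   tangent spaces are identified with [V] and a vector field is a map V -> V. *)
Section Connections.
Variables (R : realType) (V : normedModType R).
Implicit Types (X Y Z : V -> V) (f : V -> R).
Implicit Types (nabla : (V -> V) -> (V -> V) -> (V -> V)).
Implicit Types (g : V -> V -> V -> R).

(* [X, Y] acts on functions as X(Y f) - Y(X f). *)
Definition lie_bracket X Y : V -> V :=
  fun p => 'D_(X p) Y p - 'D_(Y p) X p.

(* Koszul's axioms; only the values of [nabla] on smooth fields matter.
   Homogeneity over R in the second argument is [conn_leibniz] for constant f. *)
Record affine_connection nabla : Prop := AffineConnection {
  conn_smooth : forall X Y, smooth X -> smooth Y -> smooth (nabla X Y);
  conn_addl : forall X Y Z, smooth X -> smooth Y -> smooth Z ->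
    forall p, nabla (fun q => X q + Y q) Z p = nabla X Z p + nabla Y Z p;
  conn_scalel : forall f X Y, smooth f -> smooth X -> smooth Y ->
    forall p, nabla (fun q => f q *: X q) Y p = f p *: nabla X Y p;
  conn_addr : forall X Y Z, smooth X -> smooth Y -> smooth Z ->
    forall p, nabla X (fun q => Y q + Z q) p = nabla X Y p + nabla X Z p;
  conn_leibniz : forall f X Y, smooth f -> smooth X -> smooth Y ->
    forall p, nabla X (fun q => f q *: Y q) p =
              f p *: nabla X Y p + 'D_(X p) f p *: Y p
}.

Definition curvature nabla X Y Z : V -> V :=
  fun p => nabla X (nabla Y Z) p - nabla Y (nabla X Z) p
           - nabla (lie_bracket X Y) Z p.

Definition torsion nabla X Y : V -> V :=
  fun p => nabla X Y p - nabla Y X p - lie_bracket X Y p.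

Definition flat nabla : Prop :=
  forall X Y Z, smooth X -> smooth Y -> smooth Z ->
  forall p, curvature nabla X Y Z p = 0.

Definition torsion_free nabla : Prop :=
  forall X Y, smooth X -> smooth Y -> forall p, torsion nabla X Y p = 0.

Definition metric_connection g nabla : Prop :=
  forall X Y Z, smooth X -> smooth Y -> smooth Z ->
  forall p, 'D_(X p) (fun q => g q (Y q) (Z q)) p =
            g p (nabla X Y p) (Z p) + g p (Y p) (nabla X Z p).

Definition levi_civita g nabla : Prop :=
  [/\ affine_connection nabla, torsion_free nabla & metric_connection g nabla].

End Connections.

Section Lorentzian.
Variable (R : realType).

Definition negative_definite_on (V : vectType R) (b : V -> V -> R)
    (W : {vspace V}) : Prop :=
  forall w, w \in W -> w != 0 -> b w w < 0.

(* The index is the largest dimension of a negative definite subspace. *)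
Definition has_index (V : vectType R) (b : V -> V -> R) (k : nat) : Prop :=
  (exists2 W : {vspace V}, \dim W = k & negative_definite_on b W) /\
  (forall W : {vspace V}, negative_definite_on b W -> (\dim W <= k)%N).

Definition nondegenerate (V : vectType R) (b : V -> V -> R) : Prop :=
  forall u, (forall v, b u v = 0) -> u = 0.

End Lorentzian.

(* An element of the oscillator group is (t, s, x, y) with z_j = x_j + i y_j. *)
Notation osc R n := (R * R * 'rV[R]_n * 'rV[R]_n)%type.

Section Oscillator.
Variables (R : realType) (n : nat) (lambda : 'rV[R]_n).
Implicit Types (p q a : osc R n).

Definition osc_t p : R := p.1.1.1.
Definition osc_s p : R := p.1.1.2.
Definition osc_z p (j : 'I_n) : R[i] := Complex (p.1.2 0 j) (p.2 0 j).

Definition osc_mk (t s : R) (z : 'I_n -> R[i]) : osc R n :=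
  (t, s, \row_j complex.Re (z j), \row_j complex.Im (z j)).

(* e^{i theta} *)
Definition expi (theta : R) : R[i] := Complex (cos theta) (sin theta).

Definition osc_mul p q : osc R n :=
  osc_mk (osc_t p + osc_t q)
    (osc_s p + osc_s q + 2^-1 * \sum_(j < n)
       complex.Im ((osc_z p j)^*%C * expi (osc_t p * lambda 0 j) * osc_z q j))
    (fun j => osc_z p j + expi (osc_t p * lambda 0 j) * osc_z q j).

Definition osc_one : osc R n := osc_mk 0 0 (fun=> 0).

Definition osc_inv p : osc R n :=
  osc_mk (- osc_t p) (- osc_s p)
    (fun j => - (expi (- (osc_t p * lambda 0 j)) * osc_z p j)).

Lemma osc_ext p q : osc_t p = osc_t q -> osc_s p = osc_s q ->
  (forall j, osc_z p j = osc_z q j) -> p = q.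
Proof.
case: p => [[[t s] x] y]; case: q => [[[t' s'] x'] y'].
rewrite /osc_t /osc_s /osc_z /=.
move=> -> -> h; congr (_, _, _, _); apply/rowP => j; by case: (h j).
Qed.

Lemma osc_z_mk t s (z : 'I_n -> R[i]) j : osc_z (osc_mk t s z) j = z j.
Proof. by rewrite /osc_z /osc_mk /= !mxE; case: (z j). Qed.

Lemma expiD (a b : R) : expi (a + b) = expi a * expi b.
Proof. by rewrite /expi cosD sinD; simpc; congr Complex; ring. Qed.

Lemma osc_z1 j : osc_z osc_one j = 0.
Proof. exact: osc_z_mk. Qed.

Lemma osc_mul_t p q : osc_t (osc_mul p q) = osc_t p + osc_t q.
Proof. by []. Qed.

Lemma osc_mul_z p q j :
  osc_z (osc_mul p q) j = osc_z p j + expi (osc_t p * lambda 0 j) * osc_z q j.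
Proof. by rewrite osc_z_mk. Qed.

Lemma osc_mul_s p q :
  osc_s (osc_mul p q) = osc_s p + osc_s q + 2^-1 * \sum_(j < n)
    complex.Im ((osc_z p j)^*%C * expi (osc_t p * lambda 0 j) * osc_z q j).
Proof. by []. Qed.

Lemma osc_mul1g p : osc_mul osc_one p = p.
Proof.
apply: osc_ext => [||j].
- by rewrite osc_mul_t add0r.
- rewrite osc_mul_s add0r big1 ?mulr0 ?addr0// => j _.
  rewrite osc_z1 conjc0 mul0r.
  by have -> : (0 : R[i]) * osc_z p j = 0 by apply: mul0r.
rewrite osc_mul_z osc_z1 add0r mul0r /expi cos0 sin0; exact: mul1r.
Qed.

Lemma osc_mulA p q a : osc_mul p (osc_mul q a) = osc_mul (osc_mul p q) a.
Proof.
apply: osc_ext => [||j].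
- by rewrite !osc_mul_t addrA.
- rewrite !osc_mul_s.
  set S1 := \sum_(j < n) _; set S2 := \sum_(j < n) _.
  set S3 := \sum_(j < n) _; set S4 := \sum_(j < n) _.
  suff h : S1 + S2 = S3 + S4.
    have -> : S2 = S3 + S4 - S1 by rewrite -h; ring.
    by ring.
  rewrite /S1 /S2 /S3 /S4 -!big_split; apply: eq_bigr => j _.
  rewrite !osc_mul_z osc_mul_t mulrDl expiD.
  have := cos2Dsin2 (osc_t p * lambda 0 j); rewrite /expi.
  move: (cos _) (sin _) (cos _) (sin _) => c' s' c s.
  case: (osc_z p j) (osc_z q j) (osc_z a j) => x y [x1 y1] [x2 y2] h.
  simpc => /=.
  apply/eqP; rewrite -subr_eq0; apply/eqP.
  transitivity ((1 - (c ^+ 2 + s ^+ 2)) *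
    (x1 * (c' * y2 + s' * x2) - y1 * (c' * x2 - s' * y2))); first ring.
  by rewrite h subrr mul0r.
by rewrite !osc_mul_z osc_mul_t mulrDl expiD; ring.
Qed.

Lemma osc_mulVg p : osc_mul (osc_inv p) p = osc_one.
Proof.
apply: osc_ext => [||j].
- by rewrite osc_mul_t addNr.
- rewrite osc_mul_s addNr add0r big1 ?mulr0// => j _.
  rewrite osc_z_mk [osc_t (osc_inv _) * _]mulNr /expi.
  move: (cos _) (sin _) (osc_z p j) => c s [x y].
  by simpc => /=; ring.
- by rewrite osc_mul_z osc_z1 osc_z_mk mulNr addNr.
Qed.

(* (L_a)_* X, where L_a is the left translation q |-> a q *)
Definition osc_push a (X : osc R n -> osc R n) : osc R n -> osc R n :=
  fun p => let q := osc_mul (osc_inv a) p in 'd (osc_mul a) q (X q).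

Definition left_invariant_connection
    (nabla : (osc R n -> osc R n) -> (osc R n -> osc R n) ->
             (osc R n -> osc R n)) : Prop :=
  forall a X Y, smooth X -> smooth Y ->
  forall p, nabla (osc_push a X) (osc_push a Y) p = osc_push a (nabla X Y) p.

Definition left_invariant_affine_structure
    (nabla : (osc R n -> osc R n) -> (osc R n -> osc R n) ->
             (osc R n -> osc R n)) : Prop :=
  [/\ affine_connection nabla, left_invariant_connection nabla,
      flat nabla & torsion_free nabla].

Record lorentzian_metric (g : osc R n -> osc R n -> osc R n -> R) : Prop :=
  LorentzianMetric {
  metric_smooth : forall u v, smooth (fun p => g p u v);
  metric_sym : forall p u v, g p u v = g p v u;
  metric_linear : forall p u, scalar (g p u);
  metric_nondegenerate : forall p, nondegenerate (g p);
  metric_index : forall p, has_index (g p) 1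
}.

Definition left_invariant_metric
    (g : osc R n -> osc R n -> osc R n -> R) : Prop :=
  forall a p u v,
    g (osc_mul a p) ('d (osc_mul a) p u) ('d (osc_mul a) p v) = g p u v.

End Oscillator.

(* Main.v *)
(* A left-invariant flat torsion-free metric connection is a bilinear product on
   the Lie algebra with u.v - v.u = [u, v], [L_u, L_v] = L_[u, v] and every L_u
   skew for the Lorentzian form B.  Let z = e_0, d = e_{-1}, e = e_j and
   f = \check e_j.  As z is central, L_z squares to 0, so that its image is
   totally isotropic, hence of dimension at most 1; being skew, L_z has even
   rank, so L_z = 0.  Thus z is orthogonal to all brackets, B(z, d) <> 0, and B
   is nonnegative on the orthogonal of z, where e.d and f.d lie.  Flatness gives
   B(e.d, e.d) + B(f.d, f.d) = 0, so e.d and f.d are null and orthogonal to e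
   and f, and B(z, d) = B(e.f - f.e, d) = 0, a contradiction. *)
Require Import Defs.
From HB Require Import structures.
From mathcomp Require Import all_boot all_order all_algebra.
From mathcomp Require Import complex ring lra.
From mathcomp Require Import all_classical all_reals all_analysis.
Import Order.TTheory GRing.Theory Num.Theory.
Import numFieldNormedType.Exports.
Local Open Scope ring_scope.

(** * Symmetric bilinear forms of index 1 *)

Section FlatLorentzian.
Context {R : realType} {V : vectType R} {B : V -> V -> R}.
Hypothesis Bsym : forall u v, B u v = B v u.
Hypothesis Blin : forall u, scalar (B u).
Hypothesis Bindex : has_index B 1.

Lemma form0r u : B u 0 = 0.
Proof. by have := Blin u (-1) 0 0; rewrite scaler0 addr0 mulN1r addNr. Qed.

Lemma formDr u v w : B u (v + w) = B u v + B u w.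
Proof. by have := Blin u 1 v w; rewrite scale1r mul1r. Qed.

Lemma formZr u k v : B u (k *: v) = k * B u v.
Proof. by have := Blin u k v 0; rewrite !addr0 form0r addr0. Qed.

Lemma formDl u v w : B (u + v) w = B u w + B v w.
Proof. by rewrite ![B _ w]Bsym formDr. Qed.

Lemma formZl k u v : B (k *: u) v = k * B u v.
Proof. by rewrite ![B _ v]Bsym formZr. Qed.

Lemma form0l v : B 0 v = 0.
Proof. by rewrite Bsym form0r. Qed.

Lemma formNr u v : B u (- v) = - B u v.
Proof. by rewrite -scaleN1r formZr mulN1r. Qed.

Lemma formNl u v : B (- u) v = - B u v.
Proof. by rewrite -scaleN1r formZl mulN1r. Qed.

Definition formE :=
  (formDl, formDr, formZl, formZr, formNl, formNr, form0l, form0r).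

(** Two orthogonal negative vectors would span a negative definite plane, which index 1 forbids. *)
Lemma negative_not_orthogonal w1 w2 :
  B w1 w1 < 0 -> B w2 w2 < 0 -> B w1 w2 != 0.
Proof.
move=> w1N w2N; apply/eqP => w12.
have w21 : B w2 w1 = 0 by rewrite Bsym.
have w1n0 : w1 != 0 by apply: contraTneq w1N => ->; rewrite form0l ltxx.
have w2n0 : w2 != 0 by apply: contraTneq w2N => ->; rewrite form0l ltxx.
have [_ /(_ (<[w1]> + <[w2]>)%VS)] := Bindex.
rewrite dimv_disjoint_sum ?dim_vline ?w1n0 ?w2n0; last first.
  apply/eqP; rewrite -subv0; apply/subvP => u.
  rewrite memv_cap => /andP[/vlineP[k ->] /vlineP[l kl]].
  have : B w1 (k *: w1) = 0 by rewrite kl formE w12 mulr0.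
  rewrite formE => /eqP; rewrite mulf_eq0 (lt_eqF w1N) orbF => /eqP ->.
  by rewrite scale0r mem0v.
suff /[swap]/[apply] : negative_definite_on B (<[w1]> + <[w2]>)%VS by [].
move=> w /memv_addP[_ /vlineP[k ->] [_ /vlineP[l ->] ->]] kl0.
rewrite !formE w12 w21 !mulr0 addr0 add0r !mulrA -!expr2.
have [k0|k0] := eqVneq k 0; last first.
  by rewrite ltr_wnDr ?pmulr_rlt0 ?exprn_even_gt0// mulr_ge0_le0 ?sqr_ge0 ?ltW.
have l0 : l != 0 by apply: contraNneq kl0 => ->; rewrite k0 !scale0r addr0.
by rewrite k0 expr0n mul0r add0r pmulr_rlt0 ?exprn_even_gt0.
Qed.

(** Otherwise the component of [w2] orthogonal to [w1], scaled by [B w1 w1] to avoid a division,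
    would be a second negative vector orthogonal to [w1]. *)
Lemma negative_reverse_schwarz w1 w2 :
  B w1 w1 < 0 -> B w2 w2 < 0 -> B w1 w1 * B w2 w2 <= B w1 w2 ^+ 2.
Proof.
move=> w1N w2N; rewrite leNgt; apply/negP => lt12.
pose w := B w1 w1 *: w2 - B w1 w2 *: w1.
have ww : B w w = B w1 w1 * (B w1 w1 * B w2 w2 - B w1 w2 ^+ 2).
  by rewrite /w !formE [B w2 w1]Bsym; ring.
have /(_ _)/eqP := negative_not_orthogonal w1 w w1N; apply.
  by rewrite ww nmulr_rlt0 ?subr_gt0.
by rewrite /w !formE; ring.
Qed.

(** Along the line [v + x *: z] the quadratic form is affine in [x] with slope [2 * B z v], so it
    takes every value. *)
Lemma isotropic_shift z v m : B z z = 0 -> B z v != 0 ->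
  exists x, B (v + x *: z) (v + x *: z) = m.
Proof.
move=> zz zv; exists ((m - B v v) / (2 * B z v)).
by rewrite !formE zz [B v z]Bsym; field.
Qed.

Section IsotropicHyperplane.
Context {z v : V}.
Hypotheses (zz : B z z = 0) (zv : B z v != 0).

(** Shifting [v] along [z] leaves [B w v] fixed while [B v v] becomes as negative as desired; a
    negative [w] would then violate the reverse Schwarz inequality. *)
Lemma isotropic_orthogonal_ge0 w : B z w = 0 -> 0 <= B w w.
Proof.
move=> zw; rewrite leNgt; apply/negP => wN.
(* The target value makes the product of the two squares equal to [B w v ^+ 2 + 1]. *)
have [x xE] := isotropic_shift z v ((B w v ^+ 2 + 1) / B w w) zz zv.
have vN : (B w v ^+ 2 + 1) / B w w < 0.
  by rewrite nmulr_llt0 ?invr_lt0// ltr_wpDl ?sqr_ge0.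
have := negative_reverse_schwarz w (v + x *: z) wN.
rewrite xE => /(_ vN).
rewrite !formE [B w z]Bsym zw mulr0 addr0 mulrC divfK ?lt_eqF//.
by rewrite gerDl ler10.
Qed.

(** A null vector of a semidefinite form lies in its radical: if [B w u] were nonzero, some shift of
    [u] along [w], still orthogonal to [z], would have square -1. *)
Lemma isotropic_orthogonal_null w u :
  B z w = 0 -> B z u = 0 -> B w w = 0 -> B w u = 0.
Proof.
move=> zw zu ww; apply/eqP/negPn/negP => wu.
have [x xE] := isotropic_shift w u (-1) ww wu.
have := isotropic_orthogonal_ge0 (u + x *: w).
by rewrite xE !formE zw zu mulr0 addr0 => /(_ erefl); rewrite ler0N1.
Qed.

End IsotropicHyperplane.

(** * Flat torsion-free products compatible with the form *)

Context {br mul : V -> V -> V}.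
Hypothesis mulZl : forall k u v, mul (k *: u) v = k *: mul u v.
Hypothesis mulZr : forall k u v, mul u (k *: v) = k *: mul u v.
Hypothesis mul_torsion_free : forall u v, mul u v = mul v u + br u v.
Hypothesis mul_flat : forall u v w,
  mul u (mul v w) = mul v (mul u w) + mul (br u v) w.
Hypothesis mul_metric : forall u v w, B (mul u v) w = - B v (mul u w).
Hypothesis Bnondeg : Defs.nondegenerate B.

Lemma mul_zerol u : mul 0 u = 0.
Proof. by have := mulZl 0 0 u; rewrite !scale0r. Qed.

Lemma mul_zeror u : mul u 0 = 0.
Proof. by have := mulZr 0 u 0; rewrite !scale0r. Qed.

Section Central.
Context {z : V}.
Hypothesis z_central : forall u, br z u = 0.

Lemma mul_central u : mul z u = mul u z.
Proof. by rewrite mul_torsion_free z_central addr0. Qed.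

(** Skewness of [mul z] and centrality give [B (mul z z) u = - B z (mul u z)], and the right-hand
    side vanishes because [mul u] is skew. *)
Lemma mul_central_self : mul z z = 0.
Proof.
apply: Bnondeg => u; rewrite mul_metric mul_central.
by have := mul_metric u z z; rewrite [B z _]Bsym; lra.
Qed.

(* Left multiplication by a central element is skew-symmetric with isotropic
   image; index 1 bounds the image by a line, and a skew-symmetric map of rank
   at most 1 vanishes. *)
Lemma mul_central_eq0 u : mul z u = 0.
Proof.
have skew x y : B (mul z x) y = - B (mul z y) x.
  by rewrite mul_metric [B x _]Bsym.
have self x : B (mul z x) x = 0.
  by have := skew x x; lra.
(* As [z] is central, flatness makes [mul z] commute with [mul x], so [mul z (mul x z)] equals
   [mul x (mul z z)], which is 0. *)
have sqr x : mul z (mul z x) = 0.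
  by rewrite [mul z x]mul_central mul_flat mul_central_self z_central
    mul_zerol mul_zeror addr0.
have iso x y : B (mul z x) (mul z y) = 0.
  by rewrite mul_metric sqr form0r oppr0.
apply: Bnondeg => v; apply/eqP/negPn/negP => puv.
have qvu : B (mul z v) u != 0 by rewrite skew oppr_eq0.
(* Both [v] and [u] are shifted, along [mul z u] and [mul z v], to the common square [m]. By [iso]
   and [self] their pairing remains [B u v], so the reverse Schwarz inequality would read
   [m ^+ 2 <= B u v ^+ 2], which this [m] violates. *)
pose m := - (B u v ^+ 2 + 1).
have mN : m < 0 by rewrite oppr_lt0 ltr_wpDl ?sqr_ge0.
have [x xE] := isotropic_shift (mul z u) v m (iso u u) puv.
have [y yE] := isotropic_shift (mul z v) u m (iso v v) qvu.
have := negative_reverse_schwarz (v + x *: mul z u) (u + y *: mul z v).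
rewrite xE yE => /(_ mN mN).
rewrite !formE iso self [B v (mul z v)]Bsym self [B v u]Bsym /m.
by have := sqr_ge0 (B u v); nra.
Qed.

Lemma mul_central_eq0r u : mul u z = 0.
Proof. by rewrite -mul_central mul_central_eq0. Qed.

Lemma central_orthogonal_mul u v : B z (mul u v) = 0.
Proof. by rewrite Bsym mul_metric mul_central_eq0r form0r oppr0. Qed.

Lemma central_orthogonal_br u v : B z (br u v) = 0.
Proof.
have := central_orthogonal_mul u v.
by rewrite mul_torsion_free formE central_orthogonal_mul add0r.
Qed.

End Central.

(** Only one pair [e], [f] is named; the other basis vectors are absorbed into the quantified [u]
    and [w]. The coefficient [a] shared by [br e u] and [br f u] produces the cancellation in
    [trace], and the last hypothesis lets nondegeneracy be tested on [d], [z] and brackets. *)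
Lemma no_flat_lorentzian_oscillator (z d e f : V) (l : R) :
  z != 0 -> l != 0 -> (forall u, br z u = 0) ->
  br d e = l *: f -> br d f = - l *: e -> br e f = z ->
  (forall u, exists a b c,
    br e u = a *: f + b *: z /\ br f u = - a *: e + c *: z) ->
  (forall u, exists a b w, u = a *: d + b *: z + br d w) -> False.
Proof.
move=> z0 l0 zC de df ef ad_ef span.
have zbr u v : B z (br u v) = 0 by apply: central_orthogonal_br.
have zmul u v : B z (mul u v) = 0 by apply: central_orthogonal_mul.
have zz : B z z = 0 by rewrite -{2}ef zbr.
(* If [z] were orthogonal to [d], it would be orthogonal to [d], to itself and to every bracket,
   hence to everything by [span]. *)
have zd : B z d != 0.
  apply: contraNneq z0 => zd; apply/eqP/Bnondeg => u.
  by have [a [b [w ->]]] := span u; rewrite !formE zd zz zbr !mulr0 !addr0.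
have zf : B z f = 0.
  by apply/eqP; have /eqP := zbr d e; rewrite de formE mulf_eq0 (negbTE l0).
have ze : B z e = 0.
  by apply/eqP; have /eqP := zbr d f;
    rewrite df formE mulf_eq0 oppr_eq0 (negbTE l0).
have trace u : B (br e u) e + B (br f u) f = 0.
  have [a [b [c [-> ->]]]] := ad_ef u.
  by rewrite !formE ze zf [B f e]Bsym; ring.
have self u x : B (mul x u) u = 0.
  by have := mul_metric x u u; rewrite [B u _]Bsym; lra.
have ed : mul e d = mul d e - l *: f.
  by rewrite [mul d e]mul_torsion_free de addrK.
have fd : mul f d = mul d f + l *: e.
  by rewrite [mul d f]mul_torsion_free df scaleNr subrK.
(* Summed over [(x, y, k) = (e, f, l)] and [(f, e, - l)], the right-hand sides
   cancel. *)
have sqr x y k : br d x = k *: y -> mul x d = mul d x - k *: y ->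
    B (mul x d) (mul x d) = - B (br x (mul d d)) x
                            - k * (B (mul y d) x + B (mul x d) y).
  move=> dx xd; rewrite {2}xd !formE.
  have -> : B (mul x d) (mul d x) = - B (mul d (mul x d)) x.
    by rewrite [B (mul d _) _]mul_metric opprK.
  (* Flatness exchanges [mul d] and [mul x]; torsion-freeness then turns [mul x (mul d d)] into
     [mul (mul d d) x] plus a bracket, and [self] removes the former. *)
  rewrite mul_flat dx mulZl [mul x (mul d d)]mul_torsion_free !formE self.
  by ring.
have ge0 x : 0 <= B (mul x d) (mul x d).
  exact: (isotropic_orthogonal_ge0 zz zd).
(* In the sum of the two instances of [sqr] the bracket terms vanish by [trace], so two nonnegative
   numbers add up to 0. *)
have [ed0 fd0] : B (mul e d) (mul e d) = 0 /\ B (mul f d) (mul f d) = 0.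
  have := sqr _ _ _ de ed; have := sqr _ _ _ df.
  rewrite scaleNr opprK => /(_ fd); have := ge0 e; have := ge0 f.
  by have := trace (mul d d); split; lra.
have edf := isotropic_orthogonal_null zz zd _ f (zmul e d) zf ed0.
have fde := isotropic_orthogonal_null zz zd _ e (zmul f d) ze fd0.
move/eqP: zd; apply.
have /(congr1 (B d)) := mul_torsion_free e f; rewrite ef formE.
rewrite [B d (mul e f)]Bsym [B d (mul f e)]Bsym !mul_metric.
by rewrite [B f _]Bsym [B e _]Bsym fde edf [B d z]Bsym oppr0 add0r => <-.
Qed.

End FlatLorentzian.

(** * Smoothness of trigonometric polynomials *)

Section TrigonometricPolynomials.
Context {R : realType} {U : normedModType R}.

Lemma is_diff_linear {W : normedModType R} {l : U -> W} (p : U) :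
  linear l -> continuous l -> is_diff p l l.
Proof.
move=> llin lcont; pose lM := GRing.isLinear.Build _ _ _ _ _ llin.
pose L : {linear U -> W} := HB.pack l lM.
apply: DiffDef; first exact: (@linear_differentiable _ _ _ L).
exact: (@diff_lin _ _ _ L).
Qed.

Lemma is_derive_linear {W : normedModType R} {l : U -> W} (p v : U) :
  linear l -> continuous l -> is_derive p v l (l v).
Proof.
move=> llin lcont; have [df dE] := is_diff_linear p llin lcont.
by apply: DeriveDef; [exact: diff_derivable|rewrite deriveE ?dE].
Qed.

Lemma is_derive_comp1 {f : R -> R} {l : U -> R} (p v : U) {df} :
  scalar l -> continuous l -> is_derive (l p) 1 f df ->
  differentiable (f \o l) p /\ is_derive p v (f \o l) (l v * df).
Proof.
move=> llin lcont [/derivable1_diffP fd <-].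
have [ld lE] := is_diff_linear p llin lcont.
have fld : differentiable (f \o l) p by exact: differentiable_comp.
split=> //; apply: DeriveDef; first exact: diff_derivable.
by rewrite deriveE// diff_comp//= lE diff1E// derive1E.
Qed.

(* The trigonometric polynomials are closed under directional derivatives, so
   that their smoothness reduces to their differentiability. *)
Inductive trig : (U -> R) -> Prop :=
| trig_cst c : trig (cst c)
| trig_lin (l : U -> R) of scalar l & continuous l : trig l
| trig_cos (l : U -> R) of scalar l & continuous l : trig (cos \o l)
| trig_sin (l : U -> R) of scalar l & continuous l : trig (sin \o l)
| trigD f g of trig f & trig g : trig (fun p => f p + g p)
| trigM f g of trig f & trig g : trig (fun p => f p * g p).

Lemma trigZ k f : trig f -> trig (fun p => k * f p).
Proof. by move=> tf; apply: (trigM (cst k)) => //; exact: trig_cst. Qed.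

Lemma trigB f g : trig f -> trig g -> trig (fun p => f p - g p).
Proof.
move=> tf tg; apply: trigD => //.
rewrite (_ : (fun p => _) = fun p => -1 * g p); first exact: trigZ.
by apply/funext => p; rewrite mulN1r.
Qed.

Lemma trig_sum n (f : 'I_n -> U -> R) :
  (forall i, trig (f i)) -> trig (fun p => \sum_(i < n) f i p).
Proof.
move=> ft; rewrite -[X in trig X]fct_sumE.
by elim/big_ind : _ => //; [exact: trig_cst|exact: trigD].
Qed.

Lemma trig_differentiable {f} p : trig f -> differentiable f p.
Proof.
elim=> {f} [c|l ll lc|l ll lc|l ll lc|f g _ fd _ gd|f g _ fd _ gd].
- exact: differentiable_cst.
- by have [] := is_diff_linear p ll lc.
- by have [] := is_derive_comp1 p 0 ll lc (is_derive_cos _).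
- by have [] := is_derive_comp1 p 0 ll lc (is_derive_sin _).
- exact: differentiableD.
- exact: differentiableM.
Qed.

Lemma trig_derive f v : trig f -> trig ('D_v f).
Proof.
have fd g p v' : trig g -> derivable g p v'.
  by move=> tg; exact/diff_derivable/trig_differentiable.
elim=> {f} [c|l ll lc|l ll lc|l ll lc|f g ft dft gt dgt|f g ft dft gt dgt].
- rewrite (_ : 'D_v _ = cst 0); first exact: trig_cst.
  by apply/funext => p; rewrite derive_cst.
- rewrite (_ : 'D_v _ = cst (l v)); first exact: trig_cst.
  by apply/funext => p; have [_ ->] := is_derive_linear p v ll lc.
- rewrite (_ : 'D_v _ = fun p => - l v * sin (l p)).
    by apply: trigZ; exact: trig_sin.
  apply/funext => p.
  by have [_ [_ ->]] := is_derive_comp1 p v ll lc (is_derive_cos _); ring.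
- rewrite (_ : 'D_v _ = fun p => l v * cos (l p)).
    by apply: trigZ; exact: trig_cos.
  apply/funext => p.
  by have [_ [_ ->]] := is_derive_comp1 p v ll lc (is_derive_sin _).
- rewrite (_ : 'D_v _ = fun p => 'D_v f p + 'D_v g p); first exact: trigD.
  by apply/funext => p; apply: deriveD; exact: fd.
- rewrite (_ : 'D_v _ = fun p => f p * 'D_v g p + g p * 'D_v f p).
    by apply: trigD; apply: trigM.
  by apply/funext => p; apply: deriveM; exact: fd.
Qed.

Context {W : normedModType R}.

(** Vector-valued trigonometric polynomials, as sums of scalar ones times fixed vectors; this shape
    is again stable under directional derivatives. *)
Inductive trig_vec : (U -> W) -> Prop :=
| trig_vecZ f w of trig f : trig_vec (fun p => f p *: w)
| trig_vecD f g of trig_vec f & trig_vec g : trig_vec (f + g).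

Lemma trig_vec_cst w : trig_vec (cst w).
Proof.
rewrite (_ : cst w = fun p => cst 1 p *: w); first exact/trig_vecZ/trig_cst.
by apply/funext => p; rewrite scale1r.
Qed.

Lemma trig_vec_sum n (f : 'I_n -> U -> W) :
  (forall i, trig_vec (f i)) -> trig_vec (\sum_(i < n) f i).
Proof.
move=> ft; elim/big_ind : _ => //; first exact: trig_vec_cst.
exact: trig_vecD.
Qed.

Lemma trig_vec_differentiable {f} p : trig_vec f -> differentiable f p.
Proof.
elim=> {f} [f w ft|f g _ fd _ gd]; last exact: differentiableD.
exact/differentiableZl/trig_differentiable.
Qed.

Lemma trig_vec_derive f v : trig_vec f -> trig_vec ('D_v f).
Proof.
elim=> {f} [f w ft|f g ft fd gt gd].
- rewrite (_ : 'D_v _ = fun p => 'D_v f p *: w).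
    exact/trig_vecZ/trig_derive.
  have fd p := trig_differentiable p ft.
  apply/funext => p; rewrite !deriveE//; last exact: differentiableZl.
  by rewrite diffZl.
- rewrite (_ : 'D_v _ = 'D_v f + 'D_v g); first exact: trig_vecD.
  apply/funext => p.
  by rewrite deriveD//; apply/diff_derivable/trig_vec_differentiable.
Qed.

Lemma trig_vec_smooth f : trig_vec f -> smooth f.
Proof.
move=> ft k; elim: k f ft => [|k IHk] f ft /=.
  by move=> p; apply/differentiable_continuous/trig_vec_differentiable.
split=> [p|v]; first exact: trig_vec_differentiable.
exact/IHk/trig_vec_derive.
Qed.

End TrigonometricPolynomials.

(** * Directional derivatives of composite maps *)

Lemma derive_linear_comp {R : realType} {U W W' : normedModType R}
    (l : W -> W') (f : U -> W) (p v : U) :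
  linear l -> continuous l -> differentiable f p ->
  'D_v (l \o f) p = l ('D_v f p).
Proof.
move=> ll lc fd; have [ld lE] := is_diff_linear (f p) ll lc.
rewrite !deriveE//; last exact: differentiable_comp.
by rewrite diff_comp//= lE.
Qed.

Lemma derive_comp {R : realType} {U W W' : normedModType R}
    {g : W -> W'} {f : U -> W} {p : U} (v : U) :
  differentiable f p -> differentiable g (f p) ->
  'D_v (g \o f) p = 'D_('D_v f p) g (f p).
Proof.
move=> fd gd; rewrite !deriveE//; last exact: differentiable_comp.
by rewrite diff_comp.
Qed.

(** * Real linear coordinates on the oscillator group *)

Section Coordinates.
Context {R : realType} {n : nat}.
Implicit Types p q u v w : osc R n.

(** Real and imaginary parts replace the complex [osc_z] because they are linear functionals over
    [R], to which the derivative rules apply. *)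
Definition osc_x (j : 'I_n) p : R := p.1.2 0 j.
Definition osc_y (j : 'I_n) p : R := p.2 0 j.

Definition osc_vec (t s : R) (x y : 'I_n -> R) : osc R n :=
  (t, s, \row_j x j, \row_j y j).

Lemma osc_x_vec t s x y j : osc_x j (osc_vec t s x y) = x j.
Proof. by rewrite /osc_x/= mxE. Qed.

Lemma osc_y_vec t s x y j : osc_y j (osc_vec t s x y) = y j.
Proof. by rewrite /osc_y/= mxE. Qed.

Lemma osc_vec_eq t s x y t' s' x' y' : t = t' -> s = s' ->
  x =1 x' -> y =1 y' -> osc_vec t s x y = osc_vec t' s' x' y'.
Proof. by move=> -> -> /funext-> /funext->. Qed.

Lemma osc_vecD t s x y t' s' x' y' : osc_vec t s x y + osc_vec t' s' x' y' =
  osc_vec (t + t') (s + s') (fun j => x j + x' j) (fun j => y j + y' j).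
Proof. by congr (_, _, _, _); apply/rowP => j; rewrite !mxE. Qed.

Lemma osc_vecZ k t s x y : k *: osc_vec t s x y =
  osc_vec (k * t) (k * s) (fun j => k * x j) (fun j => k * y j).
Proof. by congr (_, _, _, _); apply/rowP => j; rewrite !mxE. Qed.

Lemma osc_coordP p q : osc_t p = osc_t q -> osc_s p = osc_s q ->
  (forall j, osc_x j p = osc_x j q) -> (forall j, osc_y j p = osc_y j q) ->
  p = q.
Proof.
move=> t s x y; apply: osc_ext => // j.
by rewrite /osc_z -!/(osc_x j _) -!/(osc_y j _) x y.
Qed.

Lemma osc_t_linear : scalar (@osc_t R n). Proof. by []. Qed.
Lemma osc_s_linear : scalar (@osc_s R n). Proof. by []. Qed.
Lemma osc_x_linear j : scalar (osc_x j).
Proof. by move=> a u v; rewrite /osc_x !mxE. Qed.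
Lemma osc_y_linear j : scalar (osc_y j).
Proof. by move=> a u v; rewrite /osc_y !mxE. Qed.

Lemma osc_xD j u v : osc_x j (u + v) = osc_x j u + osc_x j v.
Proof. by rewrite /osc_x mxE. Qed.

Lemma osc_yD j u v : osc_y j (u + v) = osc_y j u + osc_y j v.
Proof. by rewrite /osc_y mxE. Qed.

Lemma osc_t_continuous : continuous (@osc_t R n).
Proof.
move=> p; apply: (@continuous_comp _ _ _ (fst \o fst) fst); last exact: cvg_fst.
by apply: (@continuous_comp _ _ _ fst fst); exact: cvg_fst.
Qed.

Lemma osc_s_continuous : continuous (@osc_s R n).
Proof.
move=> p; apply: (@continuous_comp _ _ _ (fst \o fst) snd); last exact: cvg_snd.
by apply: (@continuous_comp _ _ _ fst fst); exact: cvg_fst.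
Qed.

Lemma osc_x_continuous j : continuous (osc_x j).
Proof.
move=> p.
apply: (@continuous_comp _ _ _ (snd \o fst) (fun M : 'rV[R]_n => M 0 j)).
  by apply: (@continuous_comp _ _ _ fst snd); [exact: cvg_fst|exact: cvg_snd].
exact: coord_continuous.
Qed.

Lemma osc_y_continuous j : continuous (osc_y j).
Proof.
move=> p; apply: (@continuous_comp _ _ _ snd (fun M : 'rV[R]_n => M 0 j)).
  exact: cvg_snd.
exact: coord_continuous.
Qed.

(* The basis e_{-1}, e_0, e_j, \check e_j of the Lie algebra. *)
Definition osc_ed : osc R n := osc_vec 1 0 (cst 0) (cst 0).
Definition osc_ez : osc R n := osc_vec 0 1 (cst 0) (cst 0).
Definition osc_ex (j : 'I_n) : osc R n :=
  osc_vec 0 0 (fun k => (k == j)%:R) (cst 0).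
Definition osc_ey (j : 'I_n) : osc R n :=
  osc_vec 0 0 (cst 0) (fun k => (k == j)%:R).

(** This decomposition brings any map into the group to the shape required by [trig_vec]: scalar
    functions times fixed vectors. *)
Lemma osc_coord_sum p : p = osc_t p *: osc_ed + osc_s p *: osc_ez +
  \sum_j (osc_x j p *: osc_ex j + osc_y j p *: osc_ey j).
Proof.
have lE (l : osc R n -> R) : scalar l -> l (osc_t p *: osc_ed +
    osc_s p *: osc_ez + \sum_j (osc_x j p *: osc_ex j + osc_y j p *: osc_ey j))
  = osc_t p * l osc_ed + osc_s p * l osc_ez +
    \sum_j (osc_x j p * l (osc_ex j) + osc_y j p * l (osc_ey j)).
  move=> ll; pose lM := GRing.isLinear.Build _ _ _ _ _ ll.
  pose L : {linear osc R n -> R} := HB.pack l lM.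
  rewrite -[l]/(L : _ -> _) !linearD !linearZ linear_sum; congr (_ + _).
  by apply: eq_bigr => j _; rewrite linearD !linearZ.
have sum_delta (f : 'I_n -> R) j : \sum_k f k * (j == k)%:R = f j.
  rewrite (bigD1 j)//= eqxx mulr1 big1 ?addr0// => k kj.
  by rewrite eq_sym (negbTE kj) mulr0.
apply: osc_coordP => [||j|j].
- rewrite (lE _ osc_t_linear) /= mulr1 mulr0 addr0 big1 ?addr0// => j _.
  by rewrite !mulr0 addr0.
- rewrite (lE _ osc_s_linear) /= mulr1 mulr0 add0r big1 ?addr0// => j _.
  by rewrite !mulr0 addr0.
- rewrite (lE _ (osc_x_linear j)) !osc_x_vec !mulr0 addr0 add0r.
  by under eq_bigr do rewrite !osc_x_vec mulr0 addr0; rewrite sum_delta.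
- rewrite (lE _ (osc_y_linear j)) !osc_y_vec !mulr0 addr0 add0r.
  by under eq_bigr do rewrite !osc_y_vec mulr0 add0r; rewrite sum_delta.
Qed.

Lemma trig_osc {U : normedModType R} (F : U -> osc R n) :
  trig (@osc_t R n \o F) -> trig (@osc_s R n \o F) ->
  (forall j, trig (osc_x j \o F)) -> (forall j, trig (osc_y j \o F)) ->
  trig_vec F.
Proof.
move=> t s x y.
rewrite (_ : F = (fun p : U => osc_t (F p) *: osc_ed) +
    (fun p : U => osc_s (F p) *: osc_ez) +
    \sum_j ((fun p : U => osc_x j (F p) *: osc_ex j) +
            (fun p : U => osc_y j (F p) *: osc_ey j))).
  apply: trig_vecD; first by apply: trig_vecD; apply: trig_vecZ.
  apply: trig_vec_sum => j.
  by apply: trig_vecD; apply: trig_vecZ; [exact: x|exact: y].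
by apply/funext => p; rewrite {1}(osc_coord_sum (F p)) !fctE fct_sumE.
Qed.

End Coordinates.

(** * Left translations and left-invariant vector fields *)

Section LeftTranslations.
Context {R : realType} {n : nat}.
Variable lambda : 'rV[R]_n.
Implicit Types a p q u v w : osc R n.

Let c p j := cos (osc_t p * lambda 0 j).
Let s p j := sin (osc_t p * lambda 0 j).

(** In real coordinates, the sum of the $\mathrm{Im}(\bar z_j e^{it\lambda_j} z'_j)$ from the group
    law. *)
Let S p u := \sum_j
  (osc_x j p * (s p j * osc_x j u + c p j * osc_y j u)
   - osc_y j p * (c p j * osc_x j u - s p j * osc_y j u)).

(* The differential of the left translation by [p], the same at every point
   since left translations are affine; [osc_lin^~ u] is thus the left-invariant
   field with value [u] at the identity, which is [0]. *)
Definition osc_lin p u : osc R n :=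
  osc_vec (osc_t u) (osc_s u + 2^-1 * S p u)
    (fun j => c p j * osc_x j u - s p j * osc_y j u)
    (fun j => s p j * osc_x j u + c p j * osc_y j u).

Lemma osc_mulE p q : osc_mul lambda p q = p + osc_lin p q.
Proof.
apply: osc_coordP => [||j|j].
- by [].
- rewrite osc_mul_s [RHS]/osc_s/= -!/(osc_s _) -addrA; congr (_ + (_ + _ * _)).
  apply: eq_bigr => j _; rewrite /osc_z /expi -!/(osc_x _ _) -!/(osc_y _ _).
  by simpc => /=; rewrite /c /s; ring.
- by rewrite osc_xD !osc_x_vec /osc_z /expi; simpc.
- rewrite osc_yD !osc_y_vec /osc_z /expi; simpc => /=.
  by rewrite [_ + s p j * _]addrC.
Qed.

Lemma osc_lin_linear p : linear (osc_lin p).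
Proof.
move=> k u v; apply: osc_coordP => [||j|j].
- by [].
- have SE : S p (k *: u + v) = k * S p u + S p v.
    rewrite mulr_sumr -big_split; apply: eq_bigr => j _.
    by rewrite osc_x_linear osc_y_linear /=; ring.
  rewrite osc_s_linear; change (osc_s (k *: u + v) + 2^-1 * S p (k *: u + v) =
    k * (osc_s u + 2^-1 * S p u) + (osc_s v + 2^-1 * S p v)).
  by rewrite osc_s_linear SE /=; ring.
- rewrite osc_x_linear !osc_x_vec osc_x_linear osc_y_linear.
  by ring.
- rewrite osc_y_linear !osc_y_vec osc_x_linear osc_y_linear.
  by rewrite /=; ring.
Qed.

Let trigx j : trig (@osc_x R n j).
Proof. by apply: trig_lin; [exact: osc_x_linear|exact: osc_x_continuous]. Qed.

Let trigy j : trig (@osc_y R n j).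
Proof. by apply: trig_lin; [exact: osc_y_linear|exact: osc_y_continuous]. Qed.

Lemma trig_osc_lin p : trig_vec (osc_lin p).
Proof.
apply: trig_osc => [||j|j].
- by apply: trig_lin; [exact: osc_t_linear|exact: osc_t_continuous].
- apply: trigD.
    by apply: trig_lin; [exact: osc_s_linear|exact: osc_s_continuous].
  apply: trigZ; apply: trig_sum => j.
  by apply: trigB; apply: trigZ; [apply: trigD|apply: trigB]; apply: trigZ.
- rewrite (_ : _ \o _ = fun u => c p j * osc_x j u - s p j * osc_y j u).
    by apply: trigB; apply: trigZ.
  by apply/funext => u /=; rewrite osc_x_vec.
- rewrite (_ : _ \o _ = fun u => s p j * osc_x j u + c p j * osc_y j u).
    by apply: trigD; apply: trigZ.
  by apply/funext => u /=; rewrite osc_y_vec.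
Qed.

Let tl j p := osc_t p * lambda 0 j.

Let tl_linear j : scalar (tl j).
Proof. by move=> k u v; rewrite /tl osc_t_linear mulrDl -mulrA. Qed.

Let tl_continuous j : continuous (tl j).
Proof.
move=> p; apply: continuousM; last exact: cst_continuous.
exact: osc_t_continuous.
Qed.

(** Here the base point varies: the coefficients combine its coordinates with cosines and sines of
    the linear functionals [tl j]. *)
Lemma trig_osc_field u : trig_vec (osc_lin^~ u).
Proof.
have tk (k : R) : trig (fun _ : osc R n => k) by exact: trig_cst.
have tc j : trig (c^~ j) by exact: (trig_cos (tl j)).
have ts j : trig (s^~ j) by exact: (trig_sin (tl j)).
apply: trig_osc => [||j|j].
- exact: tk.
- apply: trigD; first exact: tk.
  apply: trigZ; apply: trig_sum => j.
  by apply: trigB; apply: trigM => //;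
    [apply: trigD|apply: trigB]; apply: trigM.
- rewrite (_ : _ \o _ = fun p => c p j * osc_x j u - s p j * osc_y j u).
    by apply: trigB; apply: trigM.
  by apply/funext => p /=; rewrite osc_x_vec.
- rewrite (_ : _ \o _ = fun p => s p j * osc_x j u + c p j * osc_y j u).
    by apply: trigD; apply: trigM.
  by apply/funext => p /=; rewrite osc_y_vec.
Qed.

Lemma osc_lin0 p : osc_lin p 0 = 0.
Proof.
by have := osc_lin_linear p (-1) 0 0; rewrite scaler0 addr0 scaleN1r addNr.
Qed.

Lemma osc_lin_continuous p : continuous (osc_lin p).
Proof.
move=> u; apply/differentiable_continuous/trig_vec_differentiable.
exact: trig_osc_lin.
Qed.

Lemma is_diff_osc_mul a p : is_diff p (osc_mul lambda a) (osc_lin a).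
Proof.
have -> : osc_mul lambda a = cst a + osc_lin a.
  by apply/funext => q; rewrite osc_mulE.
have lin := is_diff_linear p (osc_lin_linear a) (osc_lin_continuous a).
by rewrite -[X in is_diff _ _ X]add0r; apply: is_diffD.
Qed.

Lemma osc_one0 : osc_one R n = 0.
Proof.
by apply: osc_coordP => // j; rewrite ?osc_x_vec ?osc_y_vec /osc_x /osc_y mxE.
Qed.

Lemma osc_mulg1 p : osc_mul lambda p 0 = p.
Proof. by rewrite osc_mulE osc_lin0 addr0. Qed.

(** The usual group argument: with associativity and a left unit, left inverses are also right
    inverses. *)
Lemma osc_mulgV p : osc_mul lambda p (osc_inv lambda p) = 0.
Proof.
set q := osc_inv lambda p.
rewrite -osc_one0 -[LHS](osc_mul1g lambda) -(osc_mulVg lambda q) -osc_mulA.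
by rewrite [X in osc_mul _ _ X]osc_mulA [osc_mul _ q p]osc_mulVg osc_mul1g.
Qed.

Lemma osc_lin1 u : osc_lin 0 u = u.
Proof. by have := osc_mul1g lambda u; rewrite osc_one0 osc_mulE add0r. Qed.

Lemma osc_linZ p k u : osc_lin p (k *: u) = k *: osc_lin p u.
Proof. by have := osc_lin_linear p k u 0; rewrite osc_lin0 !addr0. Qed.

(** Associativity, with each product expanded as an affine map of its right factor; the linear parts
    must agree. *)
Lemma osc_lin_mul p q u :
  osc_lin (osc_mul lambda p q) u = osc_lin p (osc_lin q u).
Proof.
have := osc_mulA lambda p q u; rewrite !osc_mulE => /esym.
have := osc_lin_linear p 1 q (osc_lin q u); rewrite !scale1r => ->.
by rewrite addrA => /addrI.
Qed.

Lemma osc_pushE a (X : osc R n -> osc R n) p :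
  osc_push lambda a X p = osc_lin a (X (osc_mul lambda (osc_inv lambda a) p)).
Proof.
by rewrite /osc_push (@diff_val _ _ _ _ _ _ _ (is_diff_osc_mul _ _)).
Qed.

Lemma osc_push_field a u : osc_push lambda a (osc_lin^~ u) = osc_lin^~ u.
Proof.
apply/funext => p; rewrite osc_pushE -osc_lin_mul osc_mulA osc_mulgV.
by rewrite -osc_one0 osc_mul1g.
Qed.

Lemma smooth_osc_field u : smooth (osc_lin^~ u).
Proof. exact/trig_vec_smooth/trig_osc_field. Qed.

(** A left-invariant field intertwines [osc_mul lambda p] with its differential [osc_lin p];
    differentiating this identity at 0 brings the computation back to the identity element. *)
Lemma derive_osc_field p u v :
  'D_(osc_lin p u) (osc_lin^~ v) p = osc_lin p ('D_u (osc_lin^~ v) 0).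
Proof.
have fd q := trig_vec_differentiable q (trig_osc_field v).
rewrite -derive_linear_comp; last exact: fd.
- rewrite (_ : osc_lin p \o osc_lin^~ v = osc_lin^~ v \o osc_mul lambda p).
    have [md mE] := is_diff_osc_mul p 0.
    have mu : 'D_u (osc_mul lambda p) 0 = osc_lin p u.
      by rewrite (deriveE _ md) mE.
    by rewrite (derive_comp u md (fd _)) mu (osc_mulg1 p).
  by apply/funext => q /=; rewrite osc_lin_mul.
- exact: osc_lin_linear.
- exact: osc_lin_continuous.
Qed.

(** * The Lie algebra of left-invariant fields *)

Definition osc_field_diff u v : osc R n := osc_vec 0
  (2^-1 * \sum_j (osc_x j u * osc_y j v - osc_y j u * osc_x j v))
  (fun j => - (lambda 0 j * osc_t u * osc_y j v))
  (fun j => lambda 0 j * osc_t u * osc_x j v).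

(** Product rule at the identity, where the cosines are 1 and the sines and the coordinates of the
    base point are 0. *)
Lemma derive_osc_field0 u v : 'D_u (osc_lin^~ v) 0 = osc_field_diff u v.
Proof.
have fd q := trig_vec_differentiable q (trig_osc_field v).
have c0 j : c 0 j = 1 by rewrite /c mul0r cos0.
have s0 j : s 0 j = 0 by rewrite /s mul0r sin0.
have dc j : is_derive (0 : osc R n) u (c^~ j) 0.
  have [_] := is_derive_comp1 0 u (tl_linear j) (tl_continuous j)
    (is_derive_cos _).
  by rewrite /tl mul0r sin0 oppr0 mulr0.
have ds j : is_derive (0 : osc R n) u (s^~ j) (lambda 0 j * osc_t u).
  have [_] := is_derive_comp1 0 u (tl_linear j) (tl_continuous j)
    (is_derive_sin _).
  by rewrite /tl mul0r cos0 mulr1 mulrC.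
have dx j : is_derive (0 : osc R n) u (osc_x j) (osc_x j u).
  by apply: is_derive_linear; [exact: osc_x_linear|exact: osc_x_continuous].
have dy j : is_derive (0 : osc R n) u (osc_y j) (osc_y j u).
  by apply: is_derive_linear; [exact: osc_y_linear|exact: osc_y_continuous].
have coordE (l : osc R n -> R) : scalar l -> continuous l ->
    l ('D_u (osc_lin^~ v) 0) = 'D_u (l \o osc_lin^~ v) 0.
  by move=> ll lc; rewrite derive_linear_comp.
pose a j := osc_x j v; pose b j := osc_y j v.
have dX j : is_derive (0 : osc R n) u
    (c^~ j * cst (a j) - s^~ j * cst (b j)) (- (lambda 0 j * osc_t u * b j)).
  by apply: is_derive_eq; rewrite /= c0 s0 /GRing.scale/=; ring.
have dY j : is_derive (0 : osc R n) u
    (s^~ j * cst (a j) + c^~ j * cst (b j)) (lambda 0 j * osc_t u * a j).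
  by apply: is_derive_eq; rewrite /= c0 s0 /GRing.scale/=; ring.
apply: osc_coordP => [||j|j].
- rewrite coordE; [|exact: osc_t_linear|exact: osc_t_continuous].
  by rewrite (_ : _ \o _ = cst (osc_t v))// derive_cst.
- rewrite coordE; [|exact: osc_s_linear|exact: osc_s_continuous].
  rewrite (_ : _ \o _ = cst (osc_s v) + cst 2^-1 * \sum_j
      (osc_x j * (s^~ j * cst (a j) + c^~ j * cst (b j))
       - osc_y j * (c^~ j * cst (a j) - s^~ j * cst (b j)))); last first.
    by apply/funext => p; rewrite !fctE fct_sumE.
  have dS j : is_derive (0 : osc R n) u
      (osc_x j * (s^~ j * cst (a j) + c^~ j * cst (b j))
       - osc_y j * (c^~ j * cst (a j) - s^~ j * cst (b j)))
      (osc_x j u * b j - osc_y j u * a j).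
    have [x0 y0] : osc_x j (0 : osc R n) = 0 /\ osc_y j (0 : osc R n) = 0.
      by rewrite /osc_x /osc_y !mxE.
    apply: (is_derive_eq
      (is_deriveB (is_deriveM (dx j) (dY j)) (is_deriveM (dy j) (dX j)))).
    rewrite x0 y0 !scale0r !add0r.
    rewrite -[X in X *: _ - _]/(s 0 j * a j + c 0 j * b j).
    rewrite -[X in _ - X *: _]/(c 0 j * a j - s 0 j * b j).
    by rewrite c0 s0 /GRing.scale/=; ring.
  have dT := is_deriveD (is_derive_cst (osc_s v) (0 : osc R n) u)
    (is_deriveM (is_derive_cst (2^-1 : R) (0 : osc R n) u) (is_derive_sum dS)).
  by rewrite (@derive_val _ _ _ _ _ _ _ dT) /= scaler0 addr0 add0r.
- rewrite coordE; [|exact: osc_x_linear|exact: osc_x_continuous].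
  rewrite osc_x_vec -[RHS](@derive_val _ _ _ _ _ _ _ (dX j)); congr ('D_u _ 0).
  by apply/funext => p /=; rewrite osc_x_vec.
- rewrite coordE; [|exact: osc_y_linear|exact: osc_y_continuous].
  rewrite osc_y_vec -[RHS](@derive_val _ _ _ _ _ _ _ (dY j)); congr ('D_u _ 0).
  by apply/funext => p /=; rewrite osc_y_vec.
Qed.

(** The bracket of $\mathfrak{g}_\lambda$, extended bilinearly from the basis. *)
Definition osc_br u v : osc R n := osc_vec 0
  (\sum_j (osc_x j u * osc_y j v - osc_y j u * osc_x j v))
  (fun j => lambda 0 j * (osc_t v * osc_y j u - osc_t u * osc_y j v))
  (fun j => lambda 0 j * (osc_t u * osc_x j v - osc_t v * osc_x j u)).

Lemma osc_brE u v : osc_br u v = osc_field_diff u v - osc_field_diff v u.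
Proof.
pose T u v := \sum_j (osc_x j u * osc_y j v - osc_y j u * osc_x j v).
have TC : T v u = - T u v.
  by rewrite -sumrN; apply: eq_bigr => j _; ring.
apply/esym/eqP; rewrite subr_eq; apply/eqP.
rewrite osc_vecD; apply: osc_vec_eq => [||j|j].
- by rewrite addr0.
- by change (2^-1 * T u v = T u v + 2^-1 * T v u); rewrite TC; field.
- by ring.
- by ring.
Qed.

Lemma lie_bracket_osc_field u v :
  lie_bracket (osc_lin^~ u) (osc_lin^~ v) = osc_lin^~ (osc_br u v).
Proof.
apply/funext => p; rewrite /lie_bracket !derive_osc_field !derive_osc_field0.
have := osc_lin_linear p (-1) (osc_field_diff v u) (osc_field_diff u v).
by rewrite !scaleN1r [- _ + _]addrC -osc_brE [- osc_lin _ _ + _]addrC => ->.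
Qed.

Let delta_sum (f : 'I_n -> R) j : \sum_k (k == j)%:R * f k = f j.
Proof.
rewrite (bigD1 j)//= eqxx mul1r big1 ?addr0// => k /negbTE ->.
by rewrite mul0r.
Qed.

Let delta_swap (f : 'I_n -> R) j k : f k * (k == j)%:R = f j * (k == j)%:R.
Proof. by have [->//|_] := eqVneq k j; rewrite !mulr0. Qed.

Lemma osc_br_ez u : osc_br osc_ez u = 0.
Proof.
have -> : (0 : osc R n) = osc_vec 0 0 (cst 0) (cst 0).
  by apply: osc_coordP => // j; rewrite ?osc_x_vec ?osc_y_vec /osc_x /osc_y mxE.
apply: osc_vec_eq => [||j|j] //.
- by apply: big1 => j _; rewrite osc_x_vec osc_y_vec !mul0r subrr.
- by rewrite osc_y_vec /= /osc_t/=; ring.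
- by rewrite osc_x_vec /= /osc_t/=; ring.
Qed.

Lemma osc_br_ed w : osc_br osc_ed w = osc_vec 0 0
  (fun j => - (lambda 0 j * osc_y j w)) (fun j => lambda 0 j * osc_x j w).
Proof.
apply: osc_vec_eq => [||j|j] //.
- by apply: big1 => j _; rewrite osc_x_vec osc_y_vec !mul0r subrr.
- by rewrite osc_y_vec -[osc_t osc_ed]/(1 : R) /=; ring.
- by rewrite osc_x_vec -[osc_t osc_ed]/(1 : R) /=; ring.
Qed.

Lemma osc_br_ex j u : osc_br (osc_ex j) u =
  - (lambda 0 j * osc_t u) *: osc_ey j + osc_y j u *: osc_ez.
Proof.
rewrite !osc_vecZ osc_vecD; apply: osc_vec_eq => [||k|k] /=.
- by ring.
- rewrite mulr0 mulr1 add0r -(delta_sum (osc_y^~ u) j).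
  by apply: eq_bigr => k _; rewrite osc_x_vec osc_y_vec /=; ring.
- by rewrite osc_y_vec -[osc_t (osc_ex j)]/(0 : R) /=; ring.
- rewrite osc_x_vec -[osc_t (osc_ex j)]/(0 : R) /=.
  by ring: (delta_swap (lambda 0) j k).
Qed.

Lemma osc_br_ey j u : osc_br (osc_ey j) u =
  lambda 0 j * osc_t u *: osc_ex j - osc_x j u *: osc_ez.
Proof.
rewrite -scaleNr !osc_vecZ osc_vecD; apply: osc_vec_eq => [||k|k] /=.
- by ring.
- rewrite mulr0 mulr1 add0r -(delta_sum (osc_x^~ u) j) -sumrN.
  by apply: eq_bigr => k _; rewrite osc_x_vec osc_y_vec /=; ring.
- rewrite osc_y_vec -[osc_t (osc_ey j)]/(0 : R) /=.
  by ring: (delta_swap (lambda 0) j k).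
- by rewrite osc_x_vec -[osc_t (osc_ey j)]/(0 : R) /=; ring.
Qed.

Lemma osc_br_span u : (forall j, lambda 0 j != 0) -> exists (k l : R) w,
  u = k *: osc_ed + l *: osc_ez + osc_br osc_ed w.
Proof.
move=> l0; exists (osc_t u), (osc_s u).
(* On each plane of [osc_ex j] and [osc_ey j], the bracket with [osc_ed] is a quarter turn scaled by
   [lambda 0 j]; the witness is its inverse applied to [u]. *)
exists (osc_vec 0 0 (fun j => osc_y j u / lambda 0 j)
                    (fun j => - (osc_x j u / lambda 0 j))).
rewrite osc_br_ed !osc_vecZ !osc_vecD.
apply: osc_coordP => [||j|j]; rewrite ?(osc_x_vec, osc_y_vec).
- by change (osc_t u = osc_t u * 1 + osc_s u * 0 + 0); ring.
- by change (osc_s u = osc_t u * 0 + osc_s u * 1 + 0); ring.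
- by rewrite /=; field; apply: l0.
- by rewrite /=; field; apply: l0.
Qed.

Lemma osc_br_ed_ex j :
  osc_br osc_ed (osc_ex j) = lambda 0 j *: osc_ey j.
Proof.
rewrite osc_br_ed osc_vecZ; apply: osc_vec_eq => [||k|k].
- by rewrite mulr0.
- by rewrite mulr0.
- by rewrite osc_y_vec /=; ring.
- by rewrite osc_x_vec delta_swap.
Qed.

Lemma osc_br_ed_ey j :
  osc_br osc_ed (osc_ey j) = - lambda 0 j *: osc_ex j.
Proof.
rewrite osc_br_ed osc_vecZ; apply: osc_vec_eq => [||k|k].
- by rewrite mulr0.
- by rewrite mulr0.
- by rewrite osc_y_vec delta_swap mulNr.
- by rewrite osc_x_vec /=; ring.
Qed.

Lemma osc_br_ex_ey j : osc_br (osc_ex j) (osc_ey j) = osc_ez.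
Proof.
by rewrite osc_br_ex osc_y_vec eqxx scale1r mulr0 oppr0 scale0r add0r.
Qed.

End LeftTranslations.

(** * From invariant connections and metrics to products and forms on the Lie algebra *)

Theorem proposition3p1 (R : realType) (n : nat) (lambda : 'rV[R]_n)
    (n_gt0 : (0 < n)%N)
    (lambda_gt0 : forall j : 'I_n, 0 < lambda 0 j)
    (lambda_mono : forall j k : 'I_n, (j <= k)%N -> lambda 0 j <= lambda 0 k) :
  ~ exists (nabla : (osc R n -> osc R n) -> (osc R n -> osc R n) ->
                    (osc R n -> osc R n))
           (g : osc R n -> osc R n -> osc R n -> R),
      [/\ left_invariant_affine_structure lambda nabla,
          lorentzian_metric g,
          left_invariant_metric lambda g
        & levi_civita g nabla].
Proof.
move=> [nabla [g [[conn inv nflat tfree] [_ gsym glin gnd gidx] ginv]]].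
move=> [_ _ gnabla].
pose X u : osc R n -> osc R n := (osc_lin lambda)^~ u.
have Xsmooth u : smooth (X u) by exact: smooth_osc_field.
have cst_smooth (k : R) : smooth (fun _ : osc R n => k).
  exact/trig_vec_smooth/trig_vec_cst.
pose m u v := nabla (X u) (X v) 0.
(* Invariance of [nabla] under the translation by [p] determines this field at [p] by its value at
   the identity. *)
have nablaX u v : nabla (X u) (X v) = X (m u v).
  apply/funext => p; have := inv p _ _ (Xsmooth u) (Xsmooth v) p.
  rewrite !osc_push_field osc_pushE => ->; congr osc_lin.
  by rewrite osc_mulVg osc_one0.
have X0 u : X u 0 = u by rewrite /X osc_lin1.
have gX p u v : g p (X u p) (X v p) = g 0 u v.
  rewrite -(ginv p 0 u v) osc_mulg1.
  by rewrite (@diff_val _ _ _ _ _ _ _ (is_diff_osc_mul lambda p 0)).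
have XB u v : lie_bracket (X u) (X v) = X (osc_br lambda u v).
  exact: lie_bracket_osc_field.
have mZl k u v : m (k *: u) v = k *: m u v.
  rewrite -(conn_scalel conn (f := fun=> k)) //; congr (nabla _ _ _).
  by apply/funext => q; rewrite /X osc_linZ.
have mZr k u v : m u (k *: v) = k *: m u v.
  have := conn_leibniz conn (cst_smooth k) (Xsmooth u) (Xsmooth v) 0.
  rewrite derive_cst scale0r addr0 => <-; congr (nabla _ _ _).
  by apply/funext => q; rewrite /X osc_linZ.
have m_tf u v : m u v = m v u + osc_br lambda u v.
  have := tfree _ _ (Xsmooth u) (Xsmooth v) 0.
  rewrite /torsion XB X0 -/(m u v) -/(m v u).
  by rewrite -addrA -opprD => /eqP; rewrite subr_eq0 => /eqP.
have m_flat u v w : m u (m v w) = m v (m u w) + m (osc_br lambda u v) w.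
  have := nflat _ _ _ (Xsmooth u) (Xsmooth v) (Xsmooth w) 0.
  rewrite /curvature XB !nablaX !X0.
  by rewrite -addrA -opprD => /eqP; rewrite subr_eq0 => /eqP.
(* An invariant metric is constant on pairs of left-invariant fields, so the derivative in the
   metric condition vanishes. *)
have m_metric u v w : g 0 (m u v) w = - g 0 v (m u w).
  have := gnabla _ _ _ (Xsmooth u) (Xsmooth v) (Xsmooth w) 0.
  rewrite (_ : (fun q => _) = cst (g 0 v w)); last first.
    by apply/funext => q; rewrite gX.
  by rewrite derive_cst !X0 => /esym/eqP; rewrite addr_eq0 => /eqP.
(* Index 0 exists because [n] is positive; it selects the pair on which the contradiction is
   reached. *)
pose j := Ordinal n_gt0.
apply: (no_flat_lorentzian_oscillator (gsym 0) (glin 0) (gidx 0)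
  mZl mZr m_tf m_flat m_metric (gnd 0)
  osc_ez osc_ed (osc_ex j) (osc_ey j) (lambda 0 j)).
- apply/eqP => /(congr1 (@osc_s R n)) ez0.
  by have := oner_neq0 R; rewrite (ez0 : 1 = 0) eqxx.
- exact: lt0r_neq0.
- exact: osc_br_ez.
- exact: osc_br_ed_ex.
- exact: osc_br_ed_ey.
- exact: osc_br_ex_ey.
- move=> u; exists (- (lambda 0 j * osc_t u)), (osc_y j u), (- osc_x j u).
  split; first exact: osc_br_ex.
  by rewrite osc_br_ey opprK scaleNr.
- by move=> u; apply: osc_br_span => k; exact: lt0r_neq0.
Qed.
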